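(* Let $C_0, C_1\subset\mathbb{C}^2$ be irreducible complex algebraic plane curves of degree greater than one. Then $C_0$ and $C_1$ are $\mathcal{E}_2(\mathbb{C})$-equivalent if and only if $\mathcal{J}_{C_0}=\mathcal{J}_{C_1}$, where $\mathcal{J}_C$ denotes the Euclidean joint signature of $C$.
   Context: The Euclidean group $\mathcal{E}_2(\mathbb{C})$ is the group of matrices $\begin{bmatrix}\alpha c&\alpha s&a\\-s&c&b\\0&0&1\end{bmatrix}$ with $a,b,c,s\in\mathbb{C}$, $\alpha\in\{-1,1\}$, $c^2+s^2=1$. It acts on $\mathbb{C}^2$ by $g\cdot(x,y)=(\alpha(cx+sy)+a,\,-sx+cy+b)$. Two algebraic curves $C_0,C_1\subset\mathbb{C}^2$ are $\mathcal{E}_2(\mathbb{C})$-equivalent if there is $g\in\mathcal{E}_2(\mathbb{C})$ with $C_0=\overline{g\cdot C_1}$ (Zariski closure). For points $p_j=(x_j,y_j)\in\mathbb{C}^2$ put $d_{jk}=(x_j-x_k)^2+(y_j-y_k)^2$. For a curve $C$, let $d_4:C^4\to\mathbb{C}^6$ be the polynomial map sending $(p_1,p_2,p_3,p_4)$ to the tuple of all $d_{jk}$, $1\le j<k\le 4$ (in a fixed order). The Euclidean joint signature of $C$ is the image $\mathcal{J}_C=d_4(C^4)\subset\mathbb{C}^6$. *)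

(* Defs.v *)
From mathcomp Require Import all_boot all_order all_algebra.
From mathcomp Require Import classical_sets reals complex mpoly.

Set Implicit Arguments.
Unset Strict Implicit.
Unset Printing Implicit Defensive.

Import GRing.Theory.

Local Open Scope classical_set_scope.
Local Open Scope ring_scope.

Section PlaneCurves.
Variable K : fieldType.

Implicit Types (p q : K * K) (S C : set (K * K)) (F : {mpoly K[2]}).

Definition mpeval2 F p : K := F.@[fun i : 'I_2 => if val i is 0%N then p.1 else p.2].

Definition zero_locus F : set (K * K) := [set p | mpeval2 F p = 0].

Definition zariski_closure S : set (K * K) :=
  [set p | forall F, S `<=` zero_locus F -> zero_locus F p].

(* The units of {mpoly K[2]} are the nonzero constants. *)
Definition irreducible_mpoly F : Prop :=
  [/\ F != 0, F \isn't a GRing.unit &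
      forall G H : {mpoly K[2]}, F = G * H ->
        G \is a GRing.unit \/ H \is a GRing.unit].

(* msize F is the total degree of F plus one (for F != 0).  Over an
   algebraically closed field F is determined by C up to a nonzero scalar, so
   that C has a well-defined degree. *)
Definition irreducible_curve (d : nat) C : Prop :=
  exists F, [/\ irreducible_mpoly F, (msize F).-1 = d & C = zero_locus F].

Definition euclidean_mx (alpha a b c s : K) : 'M[K]_3 :=
  \matrix_(i < 3, j < 3)
    nth 0 (nth [::] [:: [:: alpha * c; alpha * s; a];
                        [::       - s;         c; b];
                        [::         0;         0; 1]] i) j.

Definition euclidean_group : set 'M[K]_3 :=
  [set g | exists alpha a b c s : K,
     [/\ alpha = -1 \/ alpha = 1, c ^+ 2 + s ^+ 2 = 1
       & g = euclidean_mx alpha a b c s]].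

(* (x, y) is identified with the column vector (x, y, 1); only the first two
   coordinates of its product with g are kept, the third one being 1 for g in
   the Euclidean group. *)
Definition mx_act (g : 'M[K]_3) p : K * K :=
  let v : 'cV[K]_3 := g *m \col_(i < 3) nth 0 [:: p.1; p.2; 1] i in
  (v (inord 0) 0, v (inord 1) 0).

Lemma mx_act_euclidean alpha a b c s x y :
  mx_act (euclidean_mx alpha a b c s) (x, y) =
  (alpha * (c * x + s * y) + a, - s * x + c * y + b).
Proof.
rewrite /mx_act; congr pair; rewrite mxE !big_ord_recl big_ord0 !mxE /= inordK //=.
  by rewrite mulr1 addr0 mulrDr !mulrA addrA.
by rewrite mulr1 addr0 addrA.
Qed.

Definition euclidean_equiv C0 C1 : Prop :=
  exists2 g, euclidean_group g & C0 = zariski_closure (mx_act g @` C1).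

Definition sqdist p q : K := (p.1 - q.1) ^+ 2 + (p.2 - q.2) ^+ 2.

Definition d4 (P : (K * K) * (K * K) * (K * K) * (K * K)) : 6.-tuple K :=
  let: (p1, p2, p3, p4) := P in
  [tuple sqdist p1 p2; sqdist p1 p3; sqdist p1 p4;
         sqdist p2 p3; sqdist p2 p4; sqdist p3 p4].

Definition joint_signature C : set (6.-tuple K) := d4 @` (C `*` C `*` C `*` C).

End PlaneCurves.

(* Main.v *)
(* In the isotropic coordinates u = x + iy and w = x - iy, squared distances are
   products du dw, and a Euclidean motion is (u, w) -> (t u + a, (w + b) / t),
   possibly followed by the exchange of u and w.  Such motions depend on three
   parameters only.  For a motion that does not map C1 into C0, the points of C1
   mapped to C0 have u-coordinates among the roots of a nonzero resultant.  Hence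
   the quadruples of points of C1 mapped to C0 by such motions form a family of
   dimension at most three, and their u-coordinates satisfy a fixed nonzero
   polynomial equation P(u1, u2, u3, u4) = 0.
   Choose four points of C1 outside P = 0, three of them not collinear.  Equality
   of the signatures gives four points of C0 with the same mutual distances, and
   Witt's theorem a motion between both quadruples.  By the choice of P it maps
   C1 into C0, hence onto C0. *)

Require Import Defs.
From HB Require Import structures.
From mathcomp Require Import all_boot all_order all_algebra.
From mathcomp Require Import classical_sets reals complex mpoly.
From mathcomp Require Import boolp ring zify.

Set Implicit Arguments.
Unset Strict Implicit.
Unset Printing Implicit Defensive.

Import Order.TTheory GRing.Theory Num.Theory.

Local Open Scope ring_scope.

(** Stated over any integral domain, so that irreducibility can be carried across the isomorphism
    between polynomials in x, y and polynomials in isotropic coordinates. *)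
Definition irreducible_elt (R : idomainType) (f : R) : Prop :=
  [/\ f != 0, f \isn't a GRing.unit &
      forall g h : R, f = g * h -> g \is a GRing.unit \/ h \is a GRing.unit].

(** * Divisibility and resultants in K[X][Y] *)

Section PlanePolynomials.
Variable K : numClosedFieldType.
Implicit Types (F G H : {poly {poly K}}) (c : {poly K}).

(** Reduction modulo X - x evaluates the coefficients at x and has values in the domain K[Y]; this
    is what makes X - x prime in K[X][Y]. *)
Lemma polyC_dvd (x : K) F :
  map_poly (horner_eval x) F = 0 -> exists H, F = ('X - x%:P)%:P * H.
Proof.
move=> F0; exists (map_poly (fun c => c %/ ('X - x%:P)) F).
apply/polyP => i; rewrite coefCM coef_map_id0 ?div0p // mulrC divpK //.
by rewrite dvdp_XsubCl; apply/eqP; move/polyP/(_ i): F0; rewrite coef_map coef0.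
Qed.

(* Gauss's lemma; since K is algebraically closed, c splits into linear
   factors, which are prime in K[X][Y]. *)
Lemma polyC_cancel c F D E : c != 0 -> c%:P * F = D * E ->
  exists D' E' c1 c2, [/\ F = D' * E', D = c1%:P * D' & E = c2%:P * E'].
Proof.
have [n] := ubnP (size c); elim: n c F D E => // n IHn c F D E.
rewrite ltnS => sz_c c0 eqF.
have [/eqP/size_poly1P[a a0 def_c]|nsz1] := eqVneq (size c) 1%N.
  exists ((a^-1)%:P%:P * D), E, a%:P, 1; split; last by rewrite mul1r.
    by rewrite -mulrA -eqF def_c mulrA -!polyCM mulVf ?mul1r.
  by rewrite mulrA -!polyCM mulfV ?mul1r.
have [x /factor_theorem[c' def_c]] := closed_rootP _ nsz1.
have c'0 : c' != 0 by apply: contraNneq c0 => c'0; rewrite def_c c'0 mul0r.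
have ltc' : (size c' < n)%N.
  by rewrite (leq_trans _ sz_c) // def_c size_Mmonic ?monicXsubC // size_XsubC addn2.
have X0 : ('X - x%:P)%:P != 0 :> {poly {poly K}} by rewrite polyC_eq0 polyXsubC_eq0.
have {eqF} eqF : ('X - x%:P)%:P * (c'%:P * F) = D * E.
  by rewrite mulrA -polyCM mulrC [in LHS](mulrC _ c') -def_c mulrC.
have : map_poly (horner_eval x) D * map_poly (horner_eval x) E = 0.
  rewrite -rmorphM -eqF rmorphM /= map_polyC /= /horner_eval.
  by rewrite hornerXsubC subrr mul0r.
move/eqP; rewrite mulf_eq0 => /orP[] /eqP /polyC_dvd [B defB].
  have /(IHn _ _ _ _ ltc' c'0) : c'%:P * F = B * E.
    by apply: (mulfI X0); rewrite eqF defB mulrA.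
  move=> [D' [E' [c1 [c2 [-> eqB ->]]]]]; rewrite defB eqB.
  by exists D', E', (('X - x%:P) * c1), c2; rewrite polyCM mulrA.
have /(IHn _ _ _ _ ltc' c'0) : c'%:P * F = D * B.
  by apply: (mulfI X0); rewrite eqF defB mulrCA.
move=> [D' [E' [c1 [c2 [-> -> eqB]]]]]; rewrite defB eqB.
by exists D', E', c1, (('X - x%:P) * c2); rewrite polyCM mulrA.
Qed.

Lemma size_gt1_nonunit F : (1 < size F)%N -> F \isn't a GRing.unit.
Proof. by move=> sF; rewrite poly_unitE; case: eqP sF => // ->. Qed.

(** A zero resultant means a common factor of positive degree in Y over K(X). Pseudo-division
    expresses this up to factors in K[X], which Gauss's lemma removes. *)
Lemma irreducible_dvd_or_resultant F G :
  irreducible_elt F -> (1 < size F)%N -> resultant F G = 0 ->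
  exists H, G = F * H.
Proof.
move=> [F0 _ irrF] sF /eqP; rewrite resultant_eq0 => sD.
have /Pdiv.Idomain.dvdpP[[c q] /= c0 eqF] := dvdp_gcdl F G.
have /Pdiv.Idomain.dvdpP[[c' q'] /= c'0 eqG] := dvdp_gcdr F G.
rewrite -mul_polyC in eqF; rewrite -mul_polyC in eqG.
have [D [E [c1 [c2 [defF _ defD]]]]] := polyC_cancel c0 eqF.
(* Up to a factor in K[X], [E] is the gcd; it has positive degree in Y and is no unit, so the
   cofactor [D] is one. *)
have uD : D \is a GRing.unit.
  have [//|uE] := irrF _ _ defF; move: sD; rewrite defD mul_polyC ltnNge.
  rewrite (leq_trans (size_scale_leq _ _)) //.
  by move: uE; rewrite poly_unitE => /andP[/eqP ->].
have {}eqG : c'%:P * G = F * (q' * c2%:P * D^-1).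
  have defE : E = F * D^-1 by rewrite defF mulrAC mulrV ?mul1r.
  by rewrite eqG defD defE; ring.
have [F' [H' [c3 [c4 [-> eqF' _]]]]] := polyC_cancel c'0 eqG.
(* In F = c3 F' the factor F' has the positive Y-degree of F, so [c3] is the unit, and F' may be
   replaced by F as a divisor of G. *)
have [u|u] := irrF _ _ eqF'; last first.
  case/negP: (size_gt1_nonunit sF); rewrite eqF' unitrM u andbT.
  have sF' : (size F' <= 1)%N by move: u; rewrite poly_unitE => /andP[/eqP ->].
  by move: sF; rewrite eqF' mul_polyC ltnNge (leq_trans (size_scale_leq _ _)).
by exists (c3%:P^-1 * H'); rewrite eqF' mulrACA mulrV ?mul1r.
Qed.

End PlanePolynomials.

(** The resultant lies in the ideal generated by [p] and [q]. The degrees may drop under [f], so no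
    specialization of the resultant itself is involved. *)
Lemma resultant_common_root (A : comNzRingType) (L : fieldType)
    (f : {rmorphism A -> L}) (p q : {poly A}) (y : L) :
  (1 < size p)%N -> (map_poly f p).[y] = 0 -> (map_poly f q).[y] = 0 ->
  f (resultant p q) = 0.
Proof.
move=> sp py qy; have [sq|sq] := ltnP 1 (size q).
  have [[u v] _ /(congr1 (fun r => (map_poly f r).[y]))] := resultant_in_ideal sp sq.
  by rewrite map_polyC hornerC rmorphD !rmorphM hornerD !hornerM py qy !mulr0 addr0.
(* For constant [q] the Sylvester matrix has only rows made of [q], whose value under [f] is zero.
   The matrix is nonempty since [p] has positive degree, so its determinant vanishes. *)
have q0 k : f q`_k = 0.
  move: qy; rewrite (size1_polyC sq) map_polyC hornerC => q0.
  by rewrite coefC; case: eqP => // _; rewrite rmorph0.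
have q1 : (size q).-1 = 0%N by move: sq; case: (size q) => [|[]].
rewrite /resultant -det_map_mx.
suff -> : map_mx f (Sylvester_mx p q) = 0.
  have d0 : (0 < (size q).-1 + (size p).-1)%N by rewrite addn_gt0 -(subnKC sp) orbT.
  by case: _ / (prednK d0); exact: det0.
apply/matrixP => i j; rewrite mxE Sylvester_mxE; case: splitP => k _; last first.
  by rewrite !mxE rmorphMn q0 mul0rn.
by case: k => k /= lt_k; exfalso; rewrite q1 in lt_k.
Qed.

Lemma exists_left_relation (L : fieldType) (I J : finType) (M : I -> J -> L) :
  (#|J| < #|I|)%N ->
  exists2 c : I -> L, (exists i, c i != 0) & forall j, \sum_i c i * M i j = 0.
Proof.
move=> ltJI; pose B := \matrix_(i < #|I|, j < #|J|) M (enum_val i) (enum_val j).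
have : kermx B != 0.
  by rewrite kermx_eq0 -row_leq_rank -ltnNge (leq_ltn_trans (rank_leq_col _)).
case/rowV0Pn => v /sub_kermxP vB /rV0Pn [k vk].
exists (fun i => v 0 (enum_rank i)); first by exists (enum_val k); rewrite enum_valK.
move=> j; have /rowP/(_ (enum_rank j)) := vB; rewrite !mxE => vBj.
rewrite -[RHS]vBj (reindex (@enum_val I predT)) /=; last exact: onW_bij (enum_val_bij _).
by apply: eq_bigr => i _; rewrite !mxE enum_rankK enum_valK.
Qed.

(** Each exponent is at most the total degree. The crude bound suffices, as only the power of [N]
    matters in the dimension count. *)
Lemma card_bmultinom (r N : nat) : (#|{: 'X_{1..r < N}}| <= N ^ r)%N.
Proof.
have ltN (m : 'X_{1..r < N}) i : (bmnm m i < N)%N.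
  by apply: leq_ltn_trans (bmdeg m); rewrite mdegE (bigD1 i) //= leq_addr.
pose f (m : 'X_{1..r < N}) : {ffun 'I_r -> 'I_N} := [ffun i => Ordinal (ltN m i)].
have : injective f.
  move=> m m' /ffunP eqf; apply/val_inj/mnmP => i.
  by have := eqf i; rewrite !ffunE => /(congr1 val).
by move/leq_card; rewrite card_ffun !card_ord.
Qed.

(** * Elimination of parameters by counting dimensions *)

Section DegreeBound.
Variables (L : fieldType) (r : nat).
Implicit Types a b : {mpoly L[r]}.

(** [msize] is the degree plus one; bounds of the form [m.+1] make degrees add up and cover the zero
    polynomial as well. *)
Lemma msizeM_bound a b m n :
  (msize a <= m.+1 -> msize b <= n.+1 -> msize (a * b) <= (m + n).+1)%N.
Proof.
have [->|a0] := eqVneq a 0; first by rewrite mul0r msize0.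
have [->|b0] := eqVneq b 0; first by rewrite mulr0 msize0.
rewrite msizeM // => sa sb.
by rewrite -subn1 leq_subLR (leq_trans (leq_add sa sb)) // addSn addnS.
Qed.

Lemma msizeX_bound a m n : (msize a <= m.+1)%N -> (msize (a ^+ n) <= (n * m).+1)%N.
Proof.
move=> sa; elim: n => [|n IHn]; first by rewrite expr0 msize1.
by rewrite exprS mulSn msizeM_bound.
Qed.

Lemma msizeD_bound a b m : (msize a <= m -> msize b <= m -> msize (a + b) <= m)%N.
Proof. by move=> sa sb; rewrite (leq_trans (msizeD_le _ _)) // geq_max sa. Qed.

Lemma msizeB_bound a b m : (msize a <= m -> msize b <= m -> msize (a - b) <= m)%N.
Proof. by move=> sa sb; rewrite msizeD_bound // mmeasureN. Qed.

Lemma msizeM_ge a b : a != 0 -> b != 0 -> (msize a <= msize (a * b))%N.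
Proof.
move=> a0 b0; rewrite msizeM //.
have sb : (0 < msize b)%N by rewrite lt0n msize_poly_eq0.
by rewrite -(prednK sb) addnS leq_addr.
Qed.

Lemma msize_prod_bound (I : finType) (F : I -> {mpoly L[r]}) m :
  (forall i, msize (F i) <= m.+1)%N -> (msize (\prod_i F i) <= (#|I| * m).+1)%N.
Proof.
move=> sF; rewrite -big_enum /= cardE; elim: (enum I) => [|i s IHs].
  by rewrite big_nil msize1.
by rewrite big_cons mulSn msizeM_bound.
Qed.

End DegreeBound.

Section Elimination.
Variables (L : fieldType) (r : nat) (Q : {poly {mpoly L[r]}}).
Let q := lead_coef Q.
Let e := (size Q).-1.

(* q^n X^n reduced modulo Q without division *)
Fixpoint pow_rem (n : nat) : {poly {mpoly L[r]}} :=
  if n is n'.+1 then q *: ('X * pow_rem n') - (pow_rem n')`_e.-1 *: Q else 1.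

Lemma size_pow_rem n : (0 < e)%N -> (size (pow_rem n) <= e)%N.
Proof.
move=> e0; elim: n => [|n IHn] /=; first by rewrite size_poly1.
apply/leq_sizeP => j; rewrite leq_eqVlt coefB !coefZ coefXM => /predU1P[<-|ltej].
  by rewrite gtn_eqF // /q lead_coefE mulrC subrr.
have j0 : (0 < j)%N := leq_trans e0 (ltnW ltej).
have sQ : (size Q <= j)%N by move: ltej; rewrite /e; case: (size Q).
have sR : (size (pow_rem n) <= j.-1)%N by rewrite (leq_trans IHn) // -ltnS prednK.
by rewrite gtn_eqF // (nth_default _ sR) (nth_default _ sQ) !mulr0 subrr.
Qed.

Lemma pow_remE v x n : (map_poly (meval v) Q).[x] = 0 ->
  (map_poly (meval v) (pow_rem n)).[x] = q.@[v] ^+ n * x ^+ n.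
Proof.
move=> Qx; elim: n => [|n IHn] /=; first by rewrite rmorph1 hornerC !expr0 mulr1.
rewrite rmorphB /= !map_polyZ rmorphM /= map_polyX.
by rewrite !hornerE Qx IHn !exprS mulr0 subr0 /= mulrACA.
Qed.

Lemma msize_pow_rem (D n k : nat) : (forall i, (msize Q`_i <= D.+1)%N) ->
  (msize (pow_rem n)`_k <= (n * D).+1)%N.
Proof.
move=> sQ; elim: n k => [|n IHn] k /=.
  by rewrite coef1; case: eqP => _; rewrite ?msize1 ?msize0.
rewrite coefB !coefZ coefXM mulSn msizeB_bound //.
  apply: msizeM_bound; first by rewrite /q lead_coefE.
  by case: eqP => _; rewrite ?msize0.
by rewrite addnC msizeM_bound.
Qed.

(* A dimension count: for n large, the n^(r+1) monomials of degree < n in each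
   x_i, multiplied by a power of q, are combinations of fewer than n^(r+1)
   products of a monomial in v and a monomial of degree < e in each x_i. *)
Lemma dependent_roots : exists2 P : {mpoly L[r.+1]}, P != 0 &
  forall v (x : 'I_r.+1 -> L), q.@[v] != 0 ->
    (forall i, (map_poly (meval v) Q).[x i] = 0) -> P.@[x] = 0.
Proof.
(* A constant Q with nonzero value has no root, so P = 1 serves. *)
have [e0|e0] := posnP e.
  exists 1; first exact: oner_neq0.
  move=> v x qv /(_ ord0).
  have sQ : (size Q <= 1)%N by move: e0; rewrite /e; case: (size Q) => [|[]].
  rewrite {1}(size1_polyC sQ) map_polyC hornerC => q0; case/negP: qv.
  by rewrite /q (size1_polyC sQ) lead_coefC q0.
have [D sQ] : exists D, forall i, (msize Q`_i <= D.+1)%N.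
  exists (\max_(i < size Q) msize Q`_i) => i.
  have [lti|lei] := ltnP i (size Q); last by rewrite nth_default ?msize0.
  by rewrite ltnW // ltnS (leq_bigmax (Ordinal lti)).
(* Since N <= ((r+1)D+1) n, there are at most e^(r+1) ((r+1)D+1)^r n^r products; [n] exceeds the
   constant, so this is less than n^(r+1). *)
pose n := (e ^ r.+1 * (r.+1 * D).+1 ^ r).+1.
pose N := (r.+1 * (n * D)).+1.
(* Represents q^n X^m modulo Q. The power of q must not depend on [m], for the reductions to enter
   one linear relation. *)
pose rho m := q ^+ (n - m) *: pow_rem m.
have s_rho m k : (m <= n)%N -> (msize (rho m)`_k <= (n * D).+1)%N.
  move=> lemn; rewrite coefZ -{2}(subnK lemn) mulnDl.
  by rewrite msizeM_bound ?msize_pow_rem ?msizeX_bound // /q lead_coefE.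
(* The coefficient of the monomial with exponents [j] in the reduction of the monomial with
   exponents [m]. *)
pose M (m : {ffun 'I_r.+1 -> 'I_n}) (j : {ffun 'I_r.+1 -> 'I_e}) :=
  \prod_i (rho (m i))`_(j i).
have sM m j : (msize (M m j) <= N)%N.
  have := @msize_prod_bound L r 'I_r.+1 (fun i => (rho (m i))`_(j i)) (n * D).
  by rewrite card_ord; apply=> i; rewrite s_rho // ltnW.
have [|c [m0 cm0] cM] := @exists_left_relation L {ffun 'I_r.+1 -> 'I_n}
    ({ffun 'I_r.+1 -> 'I_e} * 'X_{1..r < N})%type (fun m j => (M m j.1)@_(bmnm j.2)).
  rewrite card_prod !card_ffun !card_ord.
  rewrite (leq_ltn_trans (leq_mul (leqnn _) (card_bmultinom _ _))) //.
  have leN : (N <= (r.+1 * D).+1 * n)%N by rewrite /N /n; nia.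
  have leNr : (N ^ r <= ((r.+1 * D).+1 * n) ^ r)%N.
    by have [->|r0] := posnP r; rewrite ?expn0 // leq_exp2r.
  rewrite (leq_ltn_trans (leq_mul (leqnn _) leNr)) // expnMn mulnA (expnS n).
  by rewrite ltn_mul2r expn_gt0 /=.
pose mon (m : {ffun 'I_r.+1 -> 'I_n}) : 'X_{1..r.+1} := [multinom (m i : nat) | i < r.+1].
have inj_mon : injective mon.
  move=> m m' /mnmP eqm; apply/ffunP => i; apply: val_inj.
  by have := eqm i; rewrite !mnmE.
exists (\sum_m c m *: 'X_[mon m]).
  apply: contraNneq cm0 => /(congr1 (mcoeff (mon m0))).
  rewrite mcoeff0 raddf_sum /= (bigD1 m0) //= big1 => [|m nem].
    by rewrite mcoeffZ mcoeffX eqxx mulr1 addr0 => ->.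
  by rewrite mcoeffZ mcoeffX (inj_eq inj_mon) (negPf nem) mulr0.
move=> v x qv Qx; apply: (mulIf (expf_neq0 r.+1 (expf_neq0 n qv))); rewrite mul0r.
(* The relation kills the coefficients of degree below [N]; the others vanish by [sM]. *)
have M0 j : \sum_m c m *: M m j = 0.
  apply/mpolyP => k; rewrite mcoeff0 raddf_sum /=.
  have [ltk|lek] := ltnP (mdeg k) N.
    rewrite -[RHS](cM (j, BMultinom ltk)); apply: eq_bigr => m _.
    by rewrite mcoeffZ.
  apply: big1 => m _; rewrite mcoeffZ memN_msupp_eq0 ?mulr0 //.
  by rewrite msize_mdeg_ge // (leq_trans (sM _ _)).
have rhoE i (m : 'I_n) :
    q.@[v] ^+ n * x i ^+ m = \sum_(j < e) ((rho m)`_j).@[v] * x i ^+ j.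
  transitivity (map_poly (meval v) (rho m)).[x i].
    rewrite /rho map_polyZ hornerZ pow_remE //= rmorphXn /= mulrA -exprD subnK //.
    exact: ltnW.
  rewrite (@horner_coef_wide _ e).
    by apply: eq_bigr => j _; rewrite coef_map.
  rewrite (leq_trans (size_poly _ _)) // (leq_trans (size_scale_leq _ _)) //.
  exact: size_pow_rem.
rewrite raddf_sum /= mulr_suml.
transitivity (\sum_m \sum_j (c m * (M m j).@[v]) * \prod_i x i ^+ j i).
  apply: eq_bigr => m _; rewrite mevalZ mevalX -mulrA.
  have -> : (\prod_i x i ^+ mon m i) * (q.@[v] ^+ n) ^+ r.+1
          = \prod_i (q.@[v] ^+ n * x i ^+ m i).
    rewrite big_split /= prodr_const card_ord mulrC; congr (_ * _).
    by apply: eq_bigr => i _; rewrite mnmE.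
  under eq_bigr => i _ do rewrite rhoE.
  rewrite bigA_distr_bigA mulr_sumr; apply: eq_bigr => j _.
  by rewrite big_split /= mulrA rmorph_prod.
rewrite exchange_big big1 // => j _; rewrite -mulr_suml.
suff -> : \sum_m c m * (M m j).@[v] = 0 by rewrite mul0r.
rewrite -[RHS](meval0 v) -(M0 j) raddf_sum /=.
by apply: eq_bigr => m _; rewrite mevalZ.
Qed.

End Elimination.

(** * Generic scalars and nonroots of polynomials *)

Section Generic.
Variable K : numClosedFieldType.

(** The exceptions are confined to the roots of one nonzero polynomial, so that intersections
    correspond to products. *)
Definition cofinitely (S : K -> Prop) : Prop :=
  exists2 b : {poly K}, b != 0 & forall x, b.[x] != 0 -> S x.

Lemma cofinitely_nonroot (b : {poly K}) :
  b != 0 -> cofinitely (fun x => b.[x] != 0).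
Proof. by exists b. Qed.

Lemma cofinitely_ex (S : K -> Prop) : cofinitely S -> exists x, S x.
Proof.
(* In characteristic zero the first [size b] natural numbers are distinct, one more than [b] can
   have roots. *)
case=> b b0 bS; pose s := [seq k%:R : K | k <- iota 0 (size b)].
have us : uniq s.
  by rewrite map_inj_uniq ?iota_uniq // => m n /eqP; rewrite eqr_nat => /eqP.
have : ~~ all (root b) s.
  apply/negP => /(max_poly_roots b0)/(_ us).
  by rewrite size_map size_iota ltnn.
by case/allPn => x _ bx; exists x; apply: bS.
Qed.

Lemma cofinitely_sub (S S' : K -> Prop) :
  (forall x, S x -> S' x) -> cofinitely S -> cofinitely S'.
Proof. by move=> sub [b b0 bS]; exists b => // x /bS /sub. Qed.

Lemma cofinitely_and (S S' : K -> Prop) :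
  cofinitely S -> cofinitely S' -> cofinitely (fun x => S x /\ S' x).
Proof.
move=> [b b0 bS] [c c0 cS]; exists (b * c); first by rewrite mulf_neq0.
by move=> x; rewrite hornerM mulf_eq0 negb_or => /andP[/bS ? /cS].
Qed.

Lemma digits_inj (N n : nat) (a b : 'I_n -> nat) :
  (forall i, a i < N)%N -> (forall i, b i < N)%N ->
  (\sum_(i < n) a i * N ^ i = \sum_(i < n) b i * N ^ i)%N -> a =1 b.
Proof.
elim: n a b => [|n IHn] a b aN bN; first by move=> _ [].
have split0 c : (\sum_(i < n.+1) c i * N ^ i =
    c ord0 + N * \sum_(i < n) c (lift ord0 i) * N ^ i)%N.
  rewrite big_ord_recl muln1 big_distrr; congr (_ + _)%N.
  by apply: eq_bigr => i _; rewrite lift0 expnS mulnCA.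
rewrite !split0 => eqab.
have eq0 : a ord0 = b ord0.
  have := congr1 (modn^~ N) eqab.
  by rewrite !(mulnC N) !(addnC (_ ord0)) !modnMDl !modn_small.
move: eqab; rewrite eq0 => /addnI/eqP; rewrite eqn_mul2l.
have /lt0n_neq0/negPf-> : (0 < N)%N by apply: leq_ltn_trans (aN ord0).
move=> /eqP /IHn eqS i; case: (unliftP ord0 i) => [j|] -> //.
by apply: eqS.
Qed.

(* Kronecker's substitution X_i := Z^(N^i), with N above the degree *)
Lemma mpoly_nonroot (n : nat) (P : {mpoly K[n]}) :
  P != 0 -> exists v, P.@[v] != 0.
Proof.
move=> P0; pose N := msize P.
pose k (m : 'X_{1..n}) := (\sum_(i < n) m i * N ^ i)%N.
have mN m (i : 'I_n) : m \in msupp P -> (m i < N)%N.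
  move=> /msize_mdeg_lt; apply: leq_ltn_trans.
  by rewrite mdegE (bigD1 i) //= leq_addr.
pose p : {poly K} := \sum_(m <- msupp P) P@_m *: 'X^(k m).
have p0 : p != 0.
  have Pm0 : P@_(mlead P) != 0 by rewrite mleadc_eq0.
  apply: contraNneq Pm0 => /(congr1 (coefp (k (mlead P)))).
  rewrite raddf0 /= coef_sum (bigD1_seq (mlead P)) ?mlead_supp //= big_seq_cond big1.
    by rewrite addr0 coefZ coefXn eqxx mulr1 => ->.
  move=> m /andP[mP nem]; rewrite coefZ coefXn; case: eqP => [eqk|]; last first.
    by rewrite mulr0.
  case/eqP: nem; apply/mnmP; apply: (digits_inj (N := N)) (esym eqk) => i;
    apply: mN => //.
  exact: mlead_supp.
have [z pz] := cofinitely_ex (cofinitely_nonroot p0).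
exists (fun i => z ^+ (N ^ i)).
suff <- : p.[z] = P.@[fun i => z ^+ (N ^ i)] by [].
rewrite mevalE horner_sum; apply: eq_bigr => m _.
rewrite !hornerE /k; congr (_ * _); rewrite -prodrXr; apply: eq_bigr => i _.
by rewrite mulnC exprM.
Qed.

Definition subst_at (n : nat) (v : 'I_n -> K) (i : 'I_n) (x : K) (j : 'I_n) : K :=
  if j == i then x else v j.

(** Lets the coordinates of a nonroot be replaced one at a time. The one-variable polynomial
    obtained is nonzero because its value at [v i] is that of P at [v]. *)
Lemma cofinitely_subst_at (n : nat) (P : {mpoly K[n]}) v i :
  P.@[v] != 0 -> cofinitely (fun x => P.@[subst_at v i x] != 0).
Proof.
move=> Pv; pose h j : {poly K} := if j == i then 'X else (v j)%:P.
have pE x : (mmap polyC h P).[x] = P.@[subst_at v i x].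
  rewrite mevalE /mmap horner_sum; apply: eq_bigr => m _.
  rewrite hornerCM /mmap1 horner_prod; congr (_ * _); apply: eq_bigr => j _.
  by rewrite /h /subst_at horner_exp; case: eqP => _; rewrite hornerE.
exists (mmap polyC h P); last by move=> x; rewrite pE.
apply: contraNneq Pv => p0; rewrite -[P.@[v]](_ : (mmap polyC h P).[v i] = _).
  by rewrite p0 horner0.
by rewrite pE; apply: meval_eq => j; rewrite /subst_at; case: eqP => // ->.
Qed.

End Generic.

(** The leading coefficient of Q may vanish at [v]. Truncating Q at the actual degree of its value
    restores a nonvanishing leading coefficient; the product over all truncations covers every
    [v]. *)
Lemma dependent_roots_nz (L : fieldType) (r : nat) (Q : {poly {mpoly L[r]}}) :
  exists2 P : {mpoly L[r.+1]}, P != 0 &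
  forall v (x : 'I_r.+1 -> L), map_poly (meval v) Q != 0 ->
    (forall i, (map_poly (meval v) Q).[x i] = 0) -> P.@[x] = 0.
Proof.
pose h s := cid2 (dependent_roots (take_poly s.+1 Q)).
exists (\prod_(s < size Q) s2val (h s)).
  by apply/prodf_neq0 => s _; exact: s2valP (h s).
move=> v x nzQ Qx; set Qv := map_poly _ Q in nzQ Qx; pose s := (size Qv).-1.
have sQv : size Qv = s.+1 by rewrite [LHS]polySpred.
have nzQs : (Q`_s).@[v] != 0 by rewrite -(coef_map (meval v)) -/Qv -lead_coefE lead_coef_eq0.
have lts : (s < size Q)%N.
  by rewrite ltnNge; apply: contra nzQs => les; rewrite nth_default ?meval0.
have lcQ : lead_coef (take_poly s.+1 Q) = Q`_s.
  have Qs : Q`_s != 0 by apply: contraNneq nzQs => ->; rewrite meval0.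
  have sT : size (take_poly s.+1 Q) = s.+1.
    apply/eqP; rewrite eqn_leq size_take_poly ltnNge.
    by apply: contra Qs => /leq_sizeP/(_ s (leqnn s)); rewrite coef_take_poly ltnSn => ->.
  by rewrite lead_coefE sT coef_take_poly ltnSn.
have mapT : map_poly (meval v) (take_poly s.+1 Q) = Qv.
  apply/polyP => j; rewrite coef_map coef_take_poly /=.
  case: ltnP => [_|lej]; first by rewrite coef_map.
  by rewrite meval0 nth_default // sQv.
have Ps : (s2val (h s)).@[x] = 0.
  by apply: (s2valP' (h s) v); rewrite ?lcQ ?mapT.
by rewrite rmorph_prod (bigD1 (Ordinal lts)) //= Ps mul0r.
Qed.

(** * Common points of a curve and a family of curves *)

Section Families.
Variable K : numClosedFieldType.
Implicit Types (F G H : {poly {poly K}}) (p : K * K).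

(* The inner variable is the first coordinate. *)
Definition evalXY F p : K := F.[p.2%:P].[p.1].

Lemma evalXY_map F x y : (map_poly (horner_eval x) F).[y] = evalXY F (x, y).
Proof.
rewrite /evalXY -[F.[_].[_]]/(horner_eval x _).
by rewrite -horner_map /= /horner_eval hornerC.
Qed.

Lemma evalXYM F G p : evalXY (F * G) p = evalXY F p * evalXY G p.
Proof. by rewrite /evalXY !hornerM. Qed.

Lemma evalXYE F p : evalXY F p = \sum_(j < size F) (F`_j).[p.1] * p.2 ^+ j.
Proof.
rewrite /evalXY (horner_coef F) horner_sum; apply: eq_bigr => j _.
by rewrite !hornerE.
Qed.

(** The first coordinates of common points are roots of the resultant, which is nonzero unless F
    divides G. *)
Lemma irreducible_common_points F G :
  irreducible_elt F -> (1 < size F)%N ->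
  (exists H, G = F * H) \/
  cofinitely (fun x => forall y, evalXY F (x, y) = 0 -> evalXY G (x, y) <> 0).
Proof.
move=> irrF sF.
have [/(irreducible_dvd_or_resultant irrF sF)|res0] := eqVneq (resultant F G) 0.
  by left.
right; apply: cofinitely_sub (cofinitely_nonroot res0) => x nzx y Fy Gy.
case/eqP: nzx; apply: (resultant_common_root (f := horner_eval x) sF (y := y));
  by rewrite evalXY_map.
Qed.

Lemma cofinitely_point F :
  (1 < size F)%N -> cofinitely (fun x => exists y, evalXY F (x, y) = 0).
Proof.
move=> sF; have lF : lead_coef F != 0 by rewrite lead_coef_eq0 -size_poly_gt0 ltnW.
apply: cofinitely_sub (cofinitely_nonroot lF) => x lx.
have [y /rootP yF] : exists y, root (map_poly (horner_eval x) F) y.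
  by apply/closed_rootP; rewrite size_map_poly_id0 // neq_ltn sF orbT.
by exists y; rewrite -evalXY_map.
Qed.

Definition specialize r (v : 'I_r -> K) (G : {poly {poly {mpoly K[r]}}}) :
  {poly {poly K}} := map_poly (map_poly (meval v)) G.

(** If F does not divide the member of the family at [v], the first coordinates of the common points
    are roots of a nonzero resultant depending on [r] parameters; [r.+1] such roots satisfy a fixed
    equation. *)
Lemma family_common_points r F (G : {poly {poly {mpoly K[r]}}}) :
  irreducible_elt F -> (1 < size F)%N ->
  exists2 P : {mpoly K[r.+1]}, P != 0 &
  forall v (p : 'I_r.+1 -> K * K), P.@[fun i => (p i).1] != 0 ->
    (forall i, evalXY F (p i) = 0) ->
    (forall i, evalXY (specialize v G) (p i) = 0) ->
    exists H, specialize v G = F * H.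
Proof.
move=> irrF sF.
pose F' : {poly {poly {mpoly K[r]}}} := map_poly (map_poly (mpolyC r (R:=K))) F.
have F'K v : specialize v F' = F.
  apply/polyP => i; apply/polyP => j; rewrite /specialize /F' !coef_map /=.
  by rewrite mevalC.
have sF' : size F' = size F.
  apply: size_map_inj_poly; last exact: rmorph0.
  by apply: map_inj_poly; [exact: (can_inj (mevalC (fun=> 0))) | exact: rmorph0].
(* The resultant commutes with specialization only if the degrees are kept, hence one truncation of
   G for each possible degree [e] of its specialization. *)
pose Q e := resultant F' (take_poly e.+1 G).
pose h e := cid2 (dependent_roots_nz (Q e)).
exists (\prod_(e < size G) s2val (h e)).
  by apply/prodf_neq0 => e _; exact: s2valP (h e).
move=> v p nzP Fp Gp; set Gv := specialize v G in Gp *.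
have [->|Gv0] := eqVneq Gv 0; first by exists 0; rewrite mulr0.
pose e := (size Gv).-1.
have sGv : size Gv = e.+1 by rewrite [LHS]polySpred.
have nzGe : map_poly (meval v) G`_e != 0.
  by rewrite -(coef_map (map_poly (meval v))) -/Gv -lead_coefE lead_coef_eq0.
have lte : (e < size G)%N.
  by rewrite ltnNge; apply: contra nzGe => lee; rewrite nth_default // rmorph0.
have specT : specialize v (take_poly e.+1 G) = Gv.
  apply/polyP => j; rewrite coef_map coef_take_poly /=.
  case: ltnP => [_|lej]; first by rewrite coef_map.
  by rewrite rmorph0 nth_default // sGv.
have sT : size (take_poly e.+1 G) = e.+1.
  apply/eqP; rewrite eqn_leq size_take_poly ltnNge; apply: contra nzGe.
  by move=> /leq_sizeP/(_ e (leqnn e)); rewrite coef_take_poly ltnSn => ->; rewrite rmorph0.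
have resE : map_poly (meval v) (Q e) = resultant F Gv.
  rewrite -specT -[in RHS](F'K v); apply: map_resultant.
    rewrite lead_coefE sF' -coef_map -/(specialize v F') F'K -lead_coefE.
    by rewrite lead_coef_eq0 -size_poly_gt0 ltnW.
  by rewrite lead_coefE sT coef_take_poly ltnSn.
have [/(irreducible_dvd_or_resultant irrF sF) //|res0] := eqVneq (resultant F Gv) 0.
case/negP: nzP; rewrite rmorph_prod (bigD1 (Ordinal lte)) //= mulf_eq0.
apply/orP; left; apply/eqP; apply: (s2valP' (h e) v); first by rewrite resE.
move=> i; rewrite resE.
apply: (resultant_common_root (f := horner_eval (p i).1) sF (y := (p i).2));
  by rewrite evalXY_map -surjective_pairing.
Qed.

End Families.

(** * Isometries in isotropic coordinates *)

Section IsotropicVectors.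
Variable L : fieldType.

(** Equality of the four products u_i w_j fixes the common ratio t = u1'/u1; the nonzero product u1
    w2 = u1' w2' permits all divisions. *)
Let isometry_vectors_aux (u1 w1 u2 w2 u1' w1' u2' w2' : L) :
  u1 * w1 = u1' * w1' -> u2 * w2 = u2' * w2' ->
  u1 * w2 = u1' * w2' -> u2 * w1 = u2' * w1' -> u1 * w2 != 0 ->
  exists2 t, t != 0 &
    [/\ u1' = t * u1, w1' = w1 / t, u2' = t * u2 & w2' = w2 / t].
Proof.
move=> e11 e22 e12 e21 nz12.
have := nz12; rewrite mulf_eq0 negb_or => /andP[u1_0 w2_0].
have := nz12; rewrite e12 mulf_eq0 negb_or => /andP[u1'0 w2'0].
exists (u1' / u1); first by rewrite mulf_neq0 ?invr_eq0.
rewrite invf_div divfK //; split=> //.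
- by apply: (mulfI u1'0); rewrite -e11; field.
- apply: (mulIf w2'0); rewrite -e22.
  transitivity (u2 * (u1' * w2') / u1); last by field.
  by rewrite -e12; field.
- by apply: (mulfI u1'0); rewrite -e12; field.
Qed.

(* Witt's theorem for the quadratic form u w; the second case is that of an
   improper isometry. *)
Lemma isometry_vectors (u1 w1 u2 w2 u1' w1' u2' w2' : L) :
  u1 * w1 = u1' * w1' -> u2 * w2 = u2' * w2' ->
  u1 * w2 + u2 * w1 = u1' * w2' + u2' * w1' -> u1 * w2 != u2 * w1 ->
  exists2 t, t != 0 &
    [/\ u1' = t * u1, w1' = w1 / t, u2' = t * u2 & w2' = w2 / t] \/
    [/\ w1' = t * u1, u1' = w1 / t, w2' = t * u2 & u2' = w2 / t].
Proof.
(* The determinant is nonzero, so one of u1 w2, u2 w1 is; exchanging the two vectors makes it the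
   first. *)
wlog nz12 : u1 w1 u2 w2 u1' w1' u2' w2' / u1 * w2 != 0.
  move=> wl e11 e22 es ne; have [z12|nz12] := eqVneq (u1 * w2) 0; last exact: wl.
  have nz21 : u2 * w1 != 0 by rewrite eq_sym -z12.
  have es' : u2 * w1 + u1 * w2 = u2' * w1' + u1' * w2' by rewrite addrC es addrC.
  have ne' : u2 * w1 != u1 * w2 by rewrite eq_sym.
  have [t t0 [[? ? ? ?]|[? ? ? ?]]] := wl _ _ _ _ _ _ _ _ nz21 e22 e11 es' ne'.
    by exists t => //; left.
  by exists t => //; right.
move=> e11 e22 es ne.
(* The pairs u1 w2, u2 w1 and u1' w2', u2' w1' have equal sums and products, hence agree up to
   order. The order decides between the proper and the improper case. *)
have : (u1 * w2 - u1' * w2') * (u1 * w2 - u2' * w1') = 0.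
  transitivity (u1 * w2 * (u1 * w2 + u2 * w1 - (u1' * w2' + u2' * w1'))
     - (u1 * w1) * (u2 * w2) + (u1' * w1') * (u2' * w2')); first by ring.
  by rewrite es -e11 -e22; ring.
move/eqP; rewrite mulf_eq0 !subr_eq0 => /orP[] /eqP e12.
  have e21 : u2 * w1 = u2' * w1' by move: es; rewrite e12 => /addrI.
  have [t t0 ?] := isometry_vectors_aux e11 e22 e12 e21 nz12.
  by exists t => //; left.
have e21 : u2 * w1 = w2' * u1'.
  by apply: (addrI (u1 * w2)); rewrite es e12 mulrC addrC.
rewrite [RHS]mulrC in e11; rewrite [RHS]mulrC in e22; rewrite [RHS]mulrC in e12.
have [t t0 ?] := isometry_vectors_aux e11 e22 e12 e21 nz12.
by exists t => //; right.
Qed.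

Definition isodist (p q : L * L) : L := (p.1 - q.1) * (p.2 - q.2).

Definition swap (p : L * L) : L * L := (p.2, p.1).

(* the proper isometries of the quadratic form u w *)
Definition motion (t a b : L) (p : L * L) : L * L := (t * p.1 + a, (p.2 + b) / t).

Definition noncollinear (p0 p1 p2 : L * L) : bool :=
  (p1.1 - p0.1) * (p2.2 - p0.2) != (p2.1 - p0.1) * (p1.2 - p0.2).

(** The difference vectors determine the motion on the first three points; the distances to these
    three points determine the fourth. *)
Lemma isometry_four_points_aux (t : L) (p0 p1 p2 p3 q0 q1 q2 q3 : L * L) :
  t != 0 -> noncollinear p0 p1 p2 ->
  isodist p0 p3 = isodist q0 q3 -> isodist p1 p3 = isodist q1 q3 ->
  isodist p2 p3 = isodist q2 q3 ->
  q1.1 - q0.1 = t * (p1.1 - p0.1) -> q1.2 - q0.2 = (p1.2 - p0.2) / t ->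
  q2.1 - q0.1 = t * (p2.1 - p0.1) -> q2.2 - q0.2 = (p2.2 - p0.2) / t ->
  exists a b, [/\ q0 = motion t a b p0, q1 = motion t a b p1,
                  q2 = motion t a b p2 & q3 = motion t a b p3].
Proof.
case: p0 p1 p2 p3 => [x0 y0] [x1 y1] [x2 y2] [x3 y3].
case: q0 q1 q2 q3 => [u0 w0] [u1 w1] [u2 w2] [u3 w3].
rewrite /noncollinear /isodist /motion /= => t0 nc e0 e1 e2 eu1 ew1 eu2 ew2.
have {}eu1 : u1 = t * (x1 - x0) + u0 by rewrite -eu1 subrK.
have {}ew1 : w1 = (y1 - y0) / t + w0 by rewrite -ew1 subrK.
have {}eu2 : u2 = t * (x2 - x0) + u0 by rewrite -eu2 subrK.
have {}ew2 : w2 = (y2 - y0) / t + w0 by rewrite -ew2 subrK.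
subst u1 w1 u2 w2.
(* The deviation of q3 from the image of p3, pulled back by the linear part. Differences of the
   distance equations are linear in [d] and [e], with nonzero determinant by noncollinearity. *)
pose d := (u3 - u0) / t - (x3 - x0); pose e := t * (w3 - w0) - (y3 - y0).
have l1 : (x1 - x0) * e + (y1 - y0) * d = 0.
  transitivity (((x1 - x3) * (y1 - y3)
      - (t * (x1 - x0) + u0 - u3) * ((y1 - y0) / t + w0 - w3))
      - ((x0 - x3) * (y0 - y3) - (u0 - u3) * (w0 - w3))).
    by rewrite /d /e; field.
  by rewrite e1 e0 !subrr.
have l2 : (x2 - x0) * e + (y2 - y0) * d = 0.
  transitivity (((x2 - x3) * (y2 - y3)
      - (t * (x2 - x0) + u0 - u3) * ((y2 - y0) / t + w0 - w3))
      - ((x0 - x3) * (y0 - y3) - (u0 - u3) * (w0 - w3))).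
    by rewrite /d /e; field.
  by rewrite e2 e0 !subrr.
have d0 : d = 0.
  apply/eqP; have: ((x1 - x0) * (y2 - y0) - (x2 - x0) * (y1 - y0)) * d == 0.
    apply/eqP; transitivity ((x1 - x0) * ((x2 - x0) * e + (y2 - y0) * d)
       - (x2 - x0) * ((x1 - x0) * e + (y1 - y0) * d)); first by ring.
    by rewrite l1 l2 !mulr0 subr0.
  by rewrite mulf_eq0 subr_eq0 (negPf nc).
have e0' : e = 0.
  apply/eqP; have: ((x1 - x0) * (y2 - y0) - (x2 - x0) * (y1 - y0)) * e == 0.
    apply/eqP; transitivity ((y2 - y0) * ((x1 - x0) * e + (y1 - y0) * d)
       - (y1 - y0) * ((x2 - x0) * e + (y2 - y0) * d)); first by ring.
    by rewrite l1 l2 !mulr0 subr0.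
  by rewrite mulf_eq0 subr_eq0 (negPf nc).
have eu3 : u3 = t * (x3 - x0) + u0.
  by rewrite -[u3](subrK u0) -[u3 - u0](divfK t0) (subr0_eq d0); ring.
have ew3 : w3 = (y3 - y0) / t + w0.
  by rewrite -(subr0_eq e0'); field.
(* Solved from the condition that the motion takes p0 to q0. *)
exists (u0 - t * x0), (t * w0 - y0); rewrite eu3 ew3.
by split; congr pair; field.
Qed.

Lemma isometry_four_points (p0 p1 p2 p3 q0 q1 q2 q3 : L * L) :
  noncollinear p0 p1 p2 ->
  isodist p0 p1 = isodist q0 q1 -> isodist p0 p2 = isodist q0 q2 ->
  isodist p0 p3 = isodist q0 q3 -> isodist p1 p2 = isodist q1 q2 ->
  isodist p1 p3 = isodist q1 q3 -> isodist p2 p3 = isodist q2 q3 ->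
  exists t a b, t != 0 /\
   ([/\ q0 = motion t a b p0, q1 = motion t a b p1,
        q2 = motion t a b p2 & q3 = motion t a b p3] \/
    [/\ swap q0 = motion t a b p0, swap q1 = motion t a b p1,
        swap q2 = motion t a b p2 & swap q3 = motion t a b p3]).
Proof.
move=> nc e01 e02 e03 e12 e13 e23.
have swapE p q : isodist (swap p) (swap q) = isodist p q by rewrite /isodist mulrC.
have [||||t t0 [[]|[]]] := @isometry_vectors (p1.1 - p0.1) (p1.2 - p0.2)
  (p2.1 - p0.1) (p2.2 - p0.2) (q1.1 - q0.1) (q1.2 - q0.2) (q2.1 - q0.1) (q2.2 - q0.2).
- move: e01; rewrite /isodist -(opprB p1.1) -(opprB p1.2).
  by rewrite -(opprB q1.1) -(opprB q1.2) !mulrNN.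
- move: e02; rewrite /isodist -(opprB p2.1) -(opprB p2.2).
  by rewrite -(opprB q2.1) -(opprB q2.2) !mulrNN.
(* Polarization: three mutual distances give the bilinear form on the difference vectors. *)
- have polar (a b c : L * L) : (b.1 - a.1) * (c.2 - a.2) + (c.1 - a.1) * (b.2 - a.2)
      = isodist a b + isodist a c - isodist b c by rewrite /isodist; ring.
  by rewrite !polar e01 e02 e12.
- exact: nc.
- move=> eu1 ew1 eu2 ew2.
  have [a [b h]] := isometry_four_points_aux t0 nc e03 e13 e23 eu1 ew1 eu2 ew2.
  by exists t, a, b; split=> //; left.
- move=> eu1 ew1 eu2 ew2.
  rewrite -[RHS]swapE in e03; rewrite -[RHS]swapE in e13; rewrite -[RHS]swapE in e23.
  have [a [b h]] := isometry_four_points_aux t0 nc e03 e13 e23 eu1 ew1 eu2 ew2.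
  by exists t, a, b; split=> //; right.
Qed.

End IsotropicVectors.

(** * Motions between plane curves *)

Section Motions.
Variable K : numClosedFieldType.
Implicit Types (F G H S T : {poly {poly K}}) (p : K * K).

Definition motion_params (t a b : K) (i : 'I_3) : K := nth 0 [:: t; a; b] i.

(* X_0 = t, X_1 = a and X_2 = b; the power of t clears denominators in
   F (t X + a, (Y + b) / t). *)
Definition moved_family F : {poly {poly {mpoly K[3]}}} :=
  \sum_(j < size F) ('X_(inord 0) ^+ (size F - j))%:P%:P
    * ('X + ('X_(inord 2))%:P%:P) ^+ j
    * (map_poly (mpolyC 3 (R:=K)) F`_j
         \Po (('X_(inord 0))%:P * 'X + ('X_(inord 1))%:P))%:P.

Lemma evalXY_moved_family F (t a b : K) p : t != 0 ->
  evalXY (specialize (motion_params t a b) (moved_family F)) p =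
  t ^+ size F * evalXY F (motion t a b p).
Proof.
move=> t0; set v := motion_params t a b.
pose E (U : {poly {poly {mpoly K[3]}}}) := evalXY (specialize v U) p.
rewrite -/(E (moved_family F)).
have EM U W : E (U * W) = E U * E W.
  by rewrite /E /specialize (rmorphM (map_poly _)) evalXYM.
have EX U k : E (U ^+ k) = E U ^+ k.
  elim: k => [|k IHk]; last by rewrite !exprS EM IHk.
  by rewrite !expr0 /E /specialize (rmorph1 (map_poly _)) /evalXY !hornerE.
have EC c : E c%:P = (map_poly (meval v) c).[p.1].
  by rewrite /E /specialize map_polyC /evalXY hornerC.
have Ev (i : 'I_3) : E ('X_i)%:P%:P = v i by rewrite EC map_polyC hornerC /= mevalXU.
have EY : E ('X + ('X_(inord 2))%:P%:P) = p.2 + b.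
  have ED U W : E (U + W) = E U + E W.
    by rewrite /E /specialize (rmorphD (map_poly _)) /evalXY !hornerD.
  rewrite ED Ev /v /motion_params inordK //; congr (_ + _).
  by rewrite /E /specialize map_polyX /evalXY hornerX hornerC.
have EF j : E (map_poly (mpolyC 3 (R:=K)) F`_j
    \Po (('X_(inord 0))%:P * 'X + ('X_(inord 1))%:P))%:P = (F`_j).[t * p.1 + a].
  rewrite EC map_comp_poly horner_comp -map_poly_comp map_poly_id => [|c _ /=]; last first.
    by rewrite mevalC.
  congr (_.[_]); rewrite rmorphD rmorphM /= map_polyX !map_polyC /= !hornerE.
  by rewrite !mevalXU /v /motion_params !inordK.
rewrite (evalXYE F) mulr_sumr /moved_family.
have ES (I : finType) (f : I -> {poly {poly {mpoly K[3]}}}) :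
    E (\sum_i f i) = \sum_i E (f i).
  by rewrite /E /specialize (rmorph_sum (map_poly _)) /evalXY !horner_sum.
rewrite ES; apply: eq_bigr => j _; rewrite !EM EX EY EF !polyC_exp EX Ev.
have -> : t ^+ size F = t ^+ (size F - j) * t ^+ j.
  by rewrite -exprD subnK // ltnW.
by rewrite /v /motion_params inordK //= exprMn exprVn; field; rewrite expf_neq0.
Qed.

Definition moves_into (m : K * K -> K * K) F G : Prop :=
  forall p, evalXY F p = 0 -> evalXY G (m p) = 0.

Lemma motion_of_four_points S T :
  irreducible_elt S -> (1 < size S)%N ->
  exists2 P : {mpoly K[4]}, P != 0 &
  forall t a b (p : 'I_4 -> K * K), t != 0 -> P.@[fun i => (p i).1] != 0 ->
    (forall i, evalXY S (p i) = 0) ->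
    (forall i, evalXY T (motion t a b (p i)) = 0) ->
    moves_into (motion t a b) S T.
Proof.
move=> irrS sS; have [P P0 hP] := family_common_points (moved_family T) irrS sS.
exists P => // t a b p t0 Pp Sp Tp.
have [i|H eqH q Sq] := hP (motion_params t a b) p Pp Sp.
  by rewrite evalXY_moved_family // Tp mulr0.
have := evalXY_moved_family T a b q t0.
rewrite eqH evalXYM Sq mul0r => /esym/eqP.
by rewrite mulf_eq0 expf_eq0 (negPf t0) andbF => /eqP.
Qed.

Lemma motionK (t a b : K) : t != 0 ->
  cancel (motion t a b) (motion t^-1 (- a / t) (- b / t)).
Proof. by move=> t0 [x y]; rewrite /motion /=; congr pair; field. Qed.

Lemma motionVK (t a b : K) : t != 0 ->
  cancel (motion t^-1 (- a / t) (- b / t)) (motion t a b).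
Proof. by move=> t0 [x y]; rewrite /motion /=; congr pair; field. Qed.

Lemma cofinitely_affine (A : K -> Prop) (t a : K) : t != 0 ->
  cofinitely A -> cofinitely (fun x => A (t * x + a)).
Proof.
move=> t0 [b b0 bA]; exists (b \Po (t *: 'X + a%:P)); last first.
  by move=> x; rewrite horner_comp !hornerE => /bA.
have [z bz] := cofinitely_ex (cofinitely_nonroot b0).
apply: contraNneq bz => /(congr1 (horner^~ ((z - a) / t))).
rewrite horner_comp hornerD hornerZ hornerX !hornerC mulrC divfK // subrK => ->.
exact: eqxx.
Qed.

(** The pullback G of S by the inverse motion vanishes on the image of S, which lies on T and has
    points over almost all first coordinates. By irreducibility T divides G, so the inverse motion
    maps T into S. *)
Lemma moves_onto S T (t a b : K) : (1 < size S)%N ->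
  irreducible_elt T -> (1 < size T)%N -> t != 0 ->
  moves_into (motion t a b) S T ->
  forall q, evalXY T q = 0 -> exists2 p, evalXY S p = 0 & q = motion t a b p.
Proof.
move=> sS irrT sT t0 ST q Tq; pose m' := motion t^-1 (- a / t) (- b / t).
exists (m' q); last by rewrite motionVK.
have tV0 : t^-1 != 0 by rewrite invr_eq0.
pose G := specialize (motion_params t^-1 (- a / t) (- b / t)) (moved_family S).
have GE p : evalXY G p = t^-1 ^+ size S * evalXY S (m' p) by apply: evalXY_moved_family.
have [[H eqG]|coG] := irreducible_common_points G irrT sT.
  have := GE q; rewrite eqG evalXYM Tq mul0r => /esym/eqP.
  by rewrite mulf_eq0 expf_eq0 (negPf tV0) andbF => /eqP.
have /cofinitely_ex [x [nG [y Sxy]]] :=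
  cofinitely_and (cofinitely_affine a t0 coG) (cofinitely_point sS).
have Gxy : evalXY G (motion t a b (x, y)) = 0 by rewrite GE /m' motionK // Sxy mulr0.
by case: (nG _ (ST _ Sxy) Gxy).
Qed.

Lemma irreducible_can (R1 R2 : idomainType) (f : {rmorphism R1 -> R2})
    (g : {rmorphism R2 -> R1}) x :
  cancel f g -> cancel g f -> irreducible_elt x -> irreducible_elt (f x).
Proof.
move=> fK gK [x0 ux irr]; split.
- by apply: contra_neq x0 => fx0; rewrite -[x]fK fx0 rmorph0.
- by apply: contra ux => /(rmorph_unit g); rewrite fK.
move=> a b eqx; have /irr[] : x = g a * g b by rewrite -rmorphM -eqx fK.
  by move=> /(rmorph_unit f); rewrite gK; left.
by move=> /(rmorph_unit f); rewrite gK; right.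
Qed.

Definition affine_poly (alpha beta gamma : K) : {poly {poly K}} :=
  (alpha *: 'X + gamma%:P)%:P + beta%:P%:P * 'X.

(** For irreducible F this says that the curve is not a line: the form in which the degree
    hypothesis passes to isotropic coordinates. *)
Definition divides_no_line F : Prop :=
  forall alpha beta gamma H,
    affine_poly alpha beta gamma = F * H -> alpha = 0 /\ beta = 0.

(** Over a closed field, an irreducible polynomial in X alone is linear and defines a line. *)
Lemma size_divides_no_line F :
  irreducible_elt F -> divides_no_line F -> (1 < size F)%N.
Proof.
move=> [F0 uF irrF] nlF; rewrite ltnNge; apply/negP => /size1_polyC eqF.
set c := F`_0 in eqF.
have c0 : c != 0 by apply: contraNneq F0 => c0; rewrite eqF c0.
have sc : size c != 1%N.
  apply: contra uF => sc; rewrite eqF poly_unitE size_polyC c0 coefC /=.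
  by rewrite poly_unitE sc unitfE; case/size_poly1P: sc => d d0 ->; rewrite coefC.
have [x /factor_theorem [d def_c]] := closed_rootP _ sc.
have eqF' : F = d%:P * ('X - x%:P)%:P by rewrite eqF def_c polyCM.
have ud : d%:P \is a @GRing.unit {poly {poly K}}.
  have [//|] := irrF _ _ eqF'.
  rewrite !poly_unitE => /andP[_ /andP[]].
  by rewrite coefC /= size_XsubC.
have [|/eqP] := nlF 1 0 (- x) (d%:P^-1); last by rewrite oner_eq0.
by rewrite eqF' mulrAC mulrV // mul1r /affine_poly polyC0 mul0r addr0 scale1r polyCN.
Qed.

Lemma swapXY_affine alpha beta gamma :
  swapXY (affine_poly alpha beta gamma) = affine_poly beta alpha gamma.
Proof.
rewrite /affine_poly rmorphD rmorphM /= !swapXY_polyC swapXY_X.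
rewrite rmorphD /= map_polyZ map_polyX !map_polyC /=.
rewrite -!mul_polyC !polyCD !polyCM; ring.
Qed.

Lemma divides_no_line_swap F : divides_no_line F -> divides_no_line (swapXY F).
Proof.
move=> nlF alpha beta gamma H /(congr1 (@swapXY K)).
by rewrite rmorphM /= swapXYK swapXY_affine => /nlF[].
Qed.

Lemma evalXY_swapXY F p : evalXY (swapXY F) (swap p) = evalXY F p.
Proof. by rewrite /evalXY /= horner2_swapXY. Qed.

Lemma evalXY_affine alpha beta gamma p :
  evalXY (affine_poly alpha beta gamma) p = alpha * p.1 + gamma + beta * p.2.
Proof. by rewrite /evalXY /affine_poly !hornerE. Qed.

(** Starting from any nonroot of P, each coordinate in turn is replaced by the first coordinate of a
    point of the curve; only finitely many values are forbidden at each stage. *)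
Lemma generic_four_points S (P : {mpoly K[4]}) :
  irreducible_elt S -> divides_no_line S -> P != 0 ->
  exists p0 p1 p2 p3, let p (i : 'I_4) := nth (0, 0) [:: p0; p1; p2; p3] i in
  [/\ P.@[fun i => (p i).1] != 0, forall i, evalXY S (p i) = 0 &
      noncollinear p0 p1 p2].
Proof.
move=> irrS nlS /mpoly_nonroot [v0 Pv0].
have coS := cofinitely_point (size_divides_no_line irrS nlS).
have [x0 [Pv1 [y0 S0]]] :=
  cofinitely_ex (cofinitely_and (cofinitely_subst_at (inord 0) Pv0) coS).
have X0 : 'X - x0%:P != 0 by rewrite polyXsubC_eq0.
have [x1 [[Pv2 [y1 S1]]]] := cofinitely_ex (cofinitely_and (cofinitely_and
  (cofinitely_subst_at (inord 1) Pv1) coS) (cofinitely_nonroot X0)).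
rewrite hornerXsubC subr_eq0 => ne10.
(* The line through the first two points. Its Y-coefficient is nonzero, so S does not divide it, and
   the third point can avoid it. *)
pose l := affine_poly (y1 - y0) (x0 - x1) (y0 * (x1 - x0) - x0 * (y1 - y0)).
have [[H /nlS[_ /eqP]]|col] :=
  irreducible_common_points l irrS (size_divides_no_line irrS nlS).
  by rewrite subr_eq0 eq_sym (negPf ne10).
have [x2 [[Pv3 [y2 S2]] nl2]] := cofinitely_ex (cofinitely_and (cofinitely_and
  (cofinitely_subst_at (inord 2) Pv2) coS) col).
have [x3 [Pv4 [y3 S3]]] :=
  cofinitely_ex (cofinitely_and (cofinitely_subst_at (inord 3) Pv3) coS).
exists (x0, y0), (x1, y1), (x2, y2), (x3, y3); split.
- apply: contraNneq Pv4 => P0; apply/eqP; rewrite -[RHS]P0; apply: meval_eq => i.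
  rewrite /subst_at -!val_eqE /= !inordK //.
  by case: i => -[|[|[|[|]]]].
- by case=> -[|[|[|[|]]]].
rewrite /noncollinear /=; apply/eqP => eqnc; apply: (nl2 _ S2).
rewrite evalXY_affine /=.
transitivity ((x2 - x0) * (y1 - y0) - (x1 - x0) * (y2 - y0)); first by ring.
by rewrite eqnc subrr.
Qed.

Lemma motion_of_isometric_points S T :
  irreducible_elt S -> divides_no_line S ->
  irreducible_elt T -> divides_no_line T ->
  (forall p0 p1 p2 p3, evalXY S p0 = 0 -> evalXY S p1 = 0 -> evalXY S p2 = 0 ->
    evalXY S p3 = 0 -> exists q0 q1 q2 q3,
    [/\ [/\ evalXY T q0 = 0, evalXY T q1 = 0, evalXY T q2 = 0 & evalXY T q3 = 0],
      [/\ isodist p0 p1 = isodist q0 q1, isodist p0 p2 = isodist q0 q2 &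
          isodist p0 p3 = isodist q0 q3]
    & [/\ isodist p1 p2 = isodist q1 q2, isodist p1 p3 = isodist q1 q3 &
          isodist p2 p3 = isodist q2 q3]]) ->
  exists t a b, t != 0 /\
   ((forall q, evalXY T q = 0 <-> exists2 p, evalXY S p = 0 & q = motion t a b p) \/
    (forall q, evalXY T q = 0 <->
       exists2 p, evalXY S p = 0 & q = swap (motion t a b p))).
Proof.
move=> irrS nlS irrT nlT isoST.
have sS := size_divides_no_line irrS nlS.
have nlT' := divides_no_line_swap nlT.
have irrT' : irreducible_elt (swapXY T).
  pose sw : {rmorphism {poly {poly K}} -> {poly {poly K}}} := @swapXY K.
  have swK : cancel sw sw := @swapXYK K.
  exact: (irreducible_can swK swK irrT).
have [P P0 hP] := motion_of_four_points T irrS sS.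
have [P' P'0 hP'] := motion_of_four_points (swapXY T) irrS sS.
(* Whether the isometry is proper is known only after the points are chosen, so they must avoid both
   exceptional loci. An improper isometry into T is a proper one into the exchanged curve. *)
have PP0 : P * P' != 0 by rewrite mulf_neq0.
have [p0 [p1 [p2 [p3]]]] := generic_four_points irrS nlS PP0.
set p := fun i : 'I_4 => _ => -[PPp Sp nc].
move: PPp; rewrite rmorphM mulf_eq0 negb_or => /andP[Pp P'p].
have [q0 [q1 [q2 [q3 [[T0 T1 T2 T3] [e01 e02 e03] [e12 e13 e23]]]]]] :=
  isoST p0 p1 p2 p3 (Sp (@Ordinal 4 0 isT)) (Sp (@Ordinal 4 1 isT))
    (Sp (@Ordinal 4 2 isT)) (Sp (@Ordinal 4 3 isT)).
have [t [a [b [t0 [[m0 m1 m2 m3]|[m0 m1 m2 m3]]]]]] :=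
  isometry_four_points nc e01 e02 e03 e12 e13 e23.
  exists t, a, b; split=> //; left.
  have mST : moves_into (motion t a b) S T.
    apply: (hP t a b p t0 Pp Sp); case=> -[|[|[|[|?]]]] ? //.
    - by rewrite /p /= -m0.
    - by rewrite /p /= -m1.
    - by rewrite /p /= -m2.
    - by rewrite /p /= -m3.
  move=> q; split=> [|[r Sr ->]]; last exact: mST.
  exact: (moves_onto sS irrT (size_divides_no_line irrT nlT) t0 mST).
exists t, a, b; split=> //; right.
have mST : moves_into (motion t a b) S (swapXY T).
  apply: (hP' t a b p t0 P'p Sp); case=> -[|[|[|[|?]]]] ? //.
  - by rewrite /p /= -m0 evalXY_swapXY.
  - by rewrite /p /= -m1 evalXY_swapXY.
  - by rewrite /p /= -m2 evalXY_swapXY.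
  - by rewrite /p /= -m3 evalXY_swapXY.
move=> q; split=> [Tq|[r Sr ->]]; last first.
  by rewrite -evalXY_swapXY; case: (motion t a b r) (mST r Sr) => [].
have T'q : evalXY (swapXY T) (swap q) = 0 by rewrite evalXY_swapXY.
have [r Sr eqr] := moves_onto sS irrT' (size_divides_no_line irrT' nlT') t0 mST T'q.
by exists r => //; rewrite -eqr; case: (q).
Qed.

End Motions.

(** * From Cartesian to isotropic coordinates *)

Section IsotropicCoordinates.
Variable K : numClosedFieldType.
Implicit Types (F : {mpoly K[2]}) (p q : K * K).

Definition iso_coord p : K * K := (p.1 + 'i * p.2, p.1 - 'i * p.2).

Definition iso_coord_inv p : K * K := ((p.1 + p.2) / 2, (p.1 - p.2) / (2 * 'i)).

Lemma iso_coordK : cancel iso_coord iso_coord_inv.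
Proof.
case=> x y; rewrite /iso_coord /iso_coord_inv /=; congr pair; field => //.
exact: neq0Ci.
Qed.

Lemma iso_coord_invK : cancel iso_coord_inv iso_coord.
Proof.
by case=> x y; rewrite /iso_coord /iso_coord_inv /=; congr pair; field; rewrite ?neq0Ci.
Qed.

Lemma isodist_iso_coord p q : isodist (iso_coord p) (iso_coord q) = sqdist p q.
Proof.
transitivity ((p.1 - q.1) ^+ 2 - 'i ^+ 2 * (p.2 - q.2) ^+ 2).
  by rewrite /isodist /=; ring.
by rewrite sqrCi mulN1r opprK.
Qed.

(** The Cartesian coordinates in terms of u, the inner variable, and w, the outer one. *)
Definition iso_var (k : 'I_2) : {poly {poly K}} :=
  if val k is 0%N then (2^-1)%:P%:P * ('X%:P + 'X)
  else ((2 * 'i)^-1)%:P%:P * ('X%:P - 'X).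

Definition to_iso F : {poly {poly K}} := mmap (polyC \o polyC) iso_var F.
HB.instance Definition _ := GRing.RMorphism.copy to_iso (mmap (polyC \o polyC) iso_var).

Definition of_iso : {poly {poly K}} -> {mpoly K[2]} :=
  horner_eval ('X_(inord 0) - 'i%:MP * 'X_(inord 1)) \o
  map_poly (horner_eval ('X_(inord 0) + 'i%:MP * 'X_(inord 1))
            \o map_poly (mpolyC 2 (R:=K))).
HB.instance Definition _ := GRing.RMorphism.on of_iso.
Arguments of_iso : simpl never.

Lemma of_isoM : {morph of_iso : G H / G * H}. Proof. exact: rmorphM. Qed.
Lemma of_isoD : {morph of_iso : G H / G + H}. Proof. exact: rmorphD. Qed.
Lemma of_isoB : {morph of_iso : G H / G - H}. Proof. exact: rmorphB. Qed.
Lemma to_isoM : {morph to_iso : F G / F * G}. Proof. exact: rmorphM. Qed.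
Lemma to_isoD : {morph to_iso : F G / F + G}. Proof. exact: rmorphD. Qed.
Lemma to_isoB : {morph to_iso : F G / F - G}. Proof. exact: rmorphB. Qed.

Lemma of_isoC c : of_iso c%:P%:P = c%:MP.
Proof. by rewrite /of_iso /= map_polyC /= map_polyC /= /horner_eval !hornerC. Qed.

Lemma of_isoX : of_iso 'X = 'X_(inord 0) - 'i%:MP * 'X_(inord 1).
Proof. by rewrite /of_iso /= map_polyX /horner_eval hornerX. Qed.

Lemma of_isoXC : of_iso 'X%:P = 'X_(inord 0) + 'i%:MP * 'X_(inord 1).
Proof. by rewrite /of_iso /= map_polyC /= map_polyX /horner_eval hornerC hornerX. Qed.

Lemma to_isoC c : to_iso c%:MP = c%:P%:P.
Proof. by rewrite /to_iso mmapC. Qed.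

Lemma to_isoX i : to_iso 'X_i = iso_var i.
Proof. by rewrite /to_iso mmapX mmap1U. Qed.

Lemma to_isoK : cancel to_iso of_iso.
Proof.
have varK i : of_iso (iso_var i) = 'X_i.
  case: i => -[|[|//]] lti; rewrite /iso_var /= of_isoM of_isoC.
    rewrite of_isoD of_isoXC of_isoX.
    have -> : Ordinal lti = inord 0 by apply: val_inj; rewrite /= inordK.
    transitivity ((2^-1)%:MP * 2%:MP * 'X_(inord 0) : {mpoly K[2]}); last first.
      by rewrite -mpolyCM mulVf ?mul1r ?pnatr_eq0.
    by rewrite mpolyCD mpolyC1; ring.
  rewrite of_isoB of_isoXC of_isoX.
  have -> : Ordinal lti = inord 1 by apply: val_inj; rewrite /= inordK.
  transitivity (((2 * 'i)^-1)%:MP * (2 * 'i)%:MP * 'X_(inord 1) : {mpoly K[2]}); last first.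
    by rewrite -mpolyCM mulVf ?mul1r // mulf_neq0 ?neq0Ci ?pnatr_eq0.
  by rewrite [in RHS]mpolyCM mpolyCD mpolyC1; ring.
pose phi := [the {rmorphism _ -> _} of of_iso \o to_iso].
move=> F; rewrite -[LHS]/(phi F) {1}[F]mpolyE rmorph_sum [RHS]mpolyE.
apply: eq_bigr => m _; rewrite -mul_mpolyC rmorphM /= to_isoC of_isoC; congr (_ * _).
rewrite -[LHS]/(phi 'X_[m]) mpolyXE_id rmorph_prod; apply: eq_bigr => i _.
by rewrite rmorphXn /= to_isoX varK.
Qed.

Lemma of_isoK : cancel of_iso to_iso.
Proof.
have to0 : to_iso 'X_(inord 0) = (2^-1)%:P%:P * ('X%:P + 'X).
  by rewrite to_isoX /iso_var /= inordK.
have to1 : to_iso ('i%:MP * 'X_(inord 1)) = (2^-1)%:P%:P * ('X%:P - 'X).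
  rewrite to_isoM to_isoC to_isoX /iso_var /= inordK // mulrA -!polyCM.
  by congr (_%:P%:P * _); rewrite invfM mulrCA mulfV ?mulr1 ?neq0Ci.
have half2 : (2^-1)%:P%:P * 2 = 1 :> {poly {poly K}}.
  have -> : 2 = 2%:P%:P :> {poly {poly K}} by rewrite !polyCMn !polyC1.
  by rewrite -!polyCM mulVf ?pnatr_eq0.
have XK : to_iso (of_iso 'X) = 'X.
  rewrite of_isoX to_isoB to0 to1.
  by transitivity ((2^-1)%:P%:P * 2 * 'X : {poly {poly K}}); [ring | rewrite half2 mul1r].
have XCK : to_iso (of_iso 'X%:P) = 'X%:P.
  rewrite of_isoXC to_isoD to0 to1.
  by transitivity ((2^-1)%:P%:P * 2 * 'X%:P : {poly {poly K}}); [ring | rewrite half2 mul1r].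
have CK (c : {poly K}) : to_iso (of_iso c%:P) = c%:P.
  elim/poly_ind: c => [|c d IHc]; first by rewrite !rmorph0.
  by rewrite polyCD polyCM of_isoD of_isoM to_isoD to_isoM IHc XCK of_isoC to_isoC.
elim/poly_ind => [|G c IHG]; first by rewrite !rmorph0.
by rewrite of_isoD of_isoM to_isoD to_isoM IHG XK CK.
Qed.

Lemma evalXY_to_iso F p : evalXY (to_iso F) (iso_coord p) = mpeval2 F p.
Proof.
rewrite /mpeval2 mevalE /to_iso /mmap /evalXY !horner_sum.
apply: eq_bigr => m _; rewrite !hornerM /= !hornerC; congr (_ * _).
rewrite /mmap1 !horner_prod; apply: eq_bigr => i _; rewrite !horner_exp; congr (_ ^+ _).
case: i => -[|k] lti; rewrite /iso_var /iso_coord;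
  rewrite !(hornerM, hornerD, hornerN, hornerC, hornerX) /=.
  by field.
by field; rewrite neq0Ci.
Qed.

Lemma irreducible_to_iso F : irreducible_mpoly F -> irreducible_elt (to_iso F).
Proof.
(* [irreducible_mpoly] and [irreducible_elt] agree by unfolding. *)
move=> irrF; have : irreducible_elt F by [].
exact: irreducible_can to_isoK of_isoK.
Qed.

(** The change of coordinates is linear, so a multiple of F would have degree at most one, while F
    has degree at least two. *)
Lemma to_iso_divides_no_line F : (2 < msize F)%N -> divides_no_line (to_iso F).
Proof.
move=> sF alpha beta gamma H eqH.
(* Degrees compare only for a nonzero multiple; the zero affine polynomial is treated by evaluation
   at three points. *)
have [l0|nl0] := eqVneq (of_iso (affine_poly alpha beta gamma)) 0.
  have {}l0 : affine_poly alpha beta gamma = 0 by rewrite -[LHS]of_isoK l0 rmorph0.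
  have ev p : alpha * p.1 + gamma + beta * p.2 = 0.
    by rewrite -evalXY_affine l0 /evalXY !hornerE.
  have := ev (0, 0); rewrite /= !mulr0 addr0 add0r => g0.
  have := ev (1, 0); have := ev (0, 1).
  by rewrite /= g0 !mulr0 !mulr1 !addr0 add0r.
have := congr1 of_iso eqH; rewrite rmorphM /= to_isoK => eqH'.
have F0 : F != 0 by apply: contraTneq sF => ->; rewrite msize0.
have H0 : of_iso H != 0 by apply: contraNneq nl0 => H0; rewrite eqH' H0 mulr0.
have : (msize (of_iso (affine_poly alpha beta gamma)) <= 2)%N.
  rewrite /affine_poly -mul_polyC polyCD polyCM.
  rewrite !(of_isoD, of_isoM, of_isoC, of_isoX, of_isoXC).
  have sC (c : K) : (msize (c%:MP : {mpoly K[2]}) <= 1)%N by rewrite msizeC; case: eqP.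
  have sX i : (msize ('X_i : {mpoly K[2]}) <= 2)%N by rewrite msizeX mdeg1.
  have sCM c (F' : {mpoly K[2]}) : (msize F' <= 2 -> msize (c%:MP * F') <= 2)%N.
    exact: (@msizeM_bound _ _ _ _ 0 1).
  apply: msizeD_bound; [apply: msizeD_bound; last exact: leq_trans (sC _) _ |];
    apply: (sCM).
    by apply: msizeD_bound; [|apply: (sCM)]; exact: sX.
  by apply: msizeB_bound; [|apply: (sCM)]; exact: sX.
rewrite eqH' leqNgt => /negP[].
exact: leq_trans sF (msizeM_ge F0 H0).
Qed.

Lemma motion_euclidean (t a b : K) : t != 0 ->
  exists2 g, @euclidean_group K g &
    forall p, iso_coord (mx_act g p) = motion t a b (iso_coord p).
Proof.
move=> t0; have i2 := sqrCi K; set j := 'i in i2 *.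
(* Solutions of c - is = t and c + is = 1/t, whose product is c^2 + s^2 = 1. Likewise x0 + i y0 = a
   and x0 - i y0 = b/t. *)
pose c := (t + t^-1) / 2; pose s := j * (t - t^-1) / 2.
pose x0 := (a + b / t) / 2; pose y0 := - j * (a - b / t) / 2.
exists (euclidean_mx 1 x0 y0 c s).
  exists 1, x0, y0, c, s; split=> //; first by right.
  by rewrite /c /s; field: i2.
case=> x y; rewrite mx_act_euclidean /iso_coord /motion /= -/j.
by congr pair; rewrite /c /s /x0 /y0; field: i2.
Qed.

Lemma swap_motion_euclidean (t a b : K) : t != 0 ->
  exists2 g, @euclidean_group K g &
    forall p, iso_coord (mx_act g p) = swap (motion t a b (iso_coord p)).
Proof.
move=> t0; have i2 := sqrCi K; set j := 'i in i2 *.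
(* With alpha = -1 the new u is -(c + is) w plus a constant, so the signs of [c] and [s] are
   reversed to give w/t. *)
pose c := - (t + t^-1) / 2; pose s := - j * (t - t^-1) / 2.
pose x0 := (b / t + a) / 2; pose y0 := - j * (b / t - a) / 2.
exists (euclidean_mx (-1) x0 y0 c s).
  exists (-1), x0, y0, c, s; split=> //; first by left.
  by rewrite /c /s; field: i2.
case=> x y; rewrite mx_act_euclidean /iso_coord /swap /motion /= -/j.
by congr pair; rewrite /c /s /x0 /y0; field: i2.
Qed.

End IsotropicCoordinates.

(** * Signatures and equivalence of curves *)

Section Signature.
Variable K : numClosedFieldType.
Implicit Types (F : {mpoly K[2]}) (p q : K * K) (C : set (K * K)) (g : 'M[K]_3).

Local Open Scope classical_set_scope.

Lemma zariski_closure_zero_locus F : zariski_closure (zero_locus F) = zero_locus F.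
Proof. by apply/seteqP; split=> p; [apply | move=> Fp G; apply]. Qed.

Lemma sqdist_euclidean g p q :
  euclidean_group g -> sqdist (mx_act g p) (mx_act g q) = sqdist p q.
Proof.
case=> alpha [a [b [c [s [halpha cs1 ->]]]]]; case: p q => [x y] [x' y'].
rewrite !mx_act_euclidean /sqdist /=.
have alpha2 : alpha ^+ 2 = 1 by case: halpha => ->; rewrite ?sqrrN expr1n.
transitivity ((c ^+ 2 + s ^+ 2) * ((x - x') ^+ 2 + (y - y') ^+ 2)
  + (alpha ^+ 2 - 1) * (c * (x - x') + s * (y - y')) ^+ 2); first by ring.
by rewrite alpha2 cs1 subrr mul0r addr0 mul1r.
Qed.

(** The equation is pulled back along the inverse motion. The image is thus already closed, and the
    Zariski closure in the equivalence changes nothing. *)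
Lemma image_zero_locus g F :
  euclidean_group g -> exists G, mx_act g @` zero_locus F = zero_locus G.
Proof.
case=> alpha [a [b [c [s [halpha cs1 ->]]]]].
have alpha2 : alpha ^+ 2 = 1 by case: halpha => ->; rewrite ?sqrrN expr1n.
have c2 : c ^+ 2 = 1 - s ^+ 2 by rewrite -cs1 addrK.
(* The linear part is orthogonal, so its inverse is the transpose. *)
pose h p := (alpha * c * (p.1 - a) - s * (p.2 - b),
             alpha * s * (p.1 - a) + c * (p.2 - b)).
have gK : cancel (mx_act (euclidean_mx alpha a b c s)) h.
  by case=> x y; rewrite mx_act_euclidean /h /=; congr pair; ring: alpha2 c2.
have hK : cancel h (mx_act (euclidean_mx alpha a b c s)).
  by case=> x y; rewrite mx_act_euclidean /=; congr pair; ring: alpha2 c2.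
pose u : {mpoly K[2]} := 'X_(inord 0) - a%:MP.
pose w : {mpoly K[2]} := 'X_(inord 1) - b%:MP.
pose G := F \mPo [tuple (alpha * c)%:MP * u - s%:MP * w;
                   (alpha * s)%:MP * u + c%:MP * w].
have GE q : mpeval2 G q = mpeval2 F (h q).
  rewrite /mpeval2 /G comp_mpoly_meval; apply: meval_eq => i.
  case: i => -[|[|//]] lti; rewrite (tnth_nth 0) /=.
    by rewrite !(mevalB, mevalD, mevalM, mevalC, mevalXU) !inordK.
  by rewrite !(mevalB, mevalD, mevalM, mevalC, mevalXU) !inordK.
exists G; apply/seteqP; split=> [_ [p Fp <-]|q Gq].
  by rewrite /zero_locus /= GE gK.
by exists (h q); rewrite ?hK // /zero_locus /= -GE.
Qed.

Lemma joint_signature_image g C :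
  euclidean_group g -> joint_signature (mx_act g @` C) = joint_signature C.
Proof.
move=> gE; apply/seteqP; split=> _ [[[[p0 p1] p2] p3] [[[/= C0 C1] C2] C3] <-].
  case: C0 C1 C2 C3 => q0 C0 <- [q1 C1 <-] [q2 C2 <-] [q3 C3 <-].
  by rewrite !sqdist_euclidean //; exists (q0, q1, q2, q3).
exists (mx_act g p0, mx_act g p1, mx_act g p2, mx_act g p3); last first.
  by rewrite /d4 !sqdist_euclidean.
by split; [split; [split|]|]; apply: imageP.
Qed.

Lemma joint_signature_equiv (C0 C1 : set (K * K)) (d0 d1 : nat) :
  (1 < d0)%N -> (1 < d1)%N -> irreducible_curve d0 C0 -> irreducible_curve d1 C1 ->
  euclidean_equiv C0 C1 <-> joint_signature C0 = joint_signature C1.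
Proof.
move=> hd0 hd1 [F0 [irr0 eqd0 eqC0]] [F1 [irr1 eqd1 eqC1]].
split=> [[g gE eqC]|eqJ].
  have [G eqG] := image_zero_locus F1 gE.
  by rewrite eqC eqC1 eqG zariski_closure_zero_locus -eqG joint_signature_image.
have gt2 n : (1 < n.-1)%N -> (2 < n)%N by case: n.
have s0 : (2 < msize F0)%N by apply: (gt2); rewrite eqd0.
have s1 : (2 < msize F1)%N by apply: (gt2); rewrite eqd1.
have in0 p : C0 p <-> evalXY (to_iso F0) (iso_coord p) = 0.
  by rewrite evalXY_to_iso eqC0.
have in1 p : C1 p <-> evalXY (to_iso F1) (iso_coord p) = 0.
  by rewrite evalXY_to_iso eqC1.
suff [g gE eqC] : exists2 g, euclidean_group g & C0 = mx_act g @` C1.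
  by exists g => //; rewrite -eqC eqC0 zariski_closure_zero_locus.
(* The source is C1 and the target C0, as in the definition of equivalence. *)
have [] := @motion_of_isometric_points K (to_iso F1) (to_iso F0)
  (irreducible_to_iso irr1) (to_iso_divides_no_line s1)
  (irreducible_to_iso irr0) (to_iso_divides_no_line s0).
  move=> p0 p1 p2 p3.
  rewrite -(iso_coord_invK p0) -(iso_coord_invK p1).
  rewrite -(iso_coord_invK p2) -(iso_coord_invK p3).
  set p0' := iso_coord_inv p0; set p1' := iso_coord_inv p1.
  set p2' := iso_coord_inv p2; set p3' := iso_coord_inv p3.
  move=> /in1 Cp0 /in1 Cp1 /in1 Cp2 /in1 Cp3.
  have : joint_signature C1 (d4 (p0', p1', p2', p3')) by exists (p0', p1', p2', p3').
  rewrite -eqJ => -[[[[q0 q1] q2] q3] [[[/= /in0 Cq0 /in0 Cq1] /in0 Cq2] /in0 Cq3]].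
  move=> [e01 e02 e03 e12 e13 e23].
  exists (iso_coord q0), (iso_coord q1), (iso_coord q2), (iso_coord q3).
  by rewrite !isodist_iso_coord.
move=> t [a [b [t0 [onto|onto]]]].
  have [g gE gm] := motion_euclidean a b t0; exists g => //.
  apply/seteqP; split=> [q /in0/onto [p Fp eqq]|_ [p /in1 Fp <-]].
    exists (iso_coord_inv p); first by apply/in1; rewrite iso_coord_invK.
    by apply: (can_inj (@iso_coordK K)); rewrite gm iso_coord_invK.
  by apply/in0/onto; exists (iso_coord p).
have [g gE gm] := swap_motion_euclidean a b t0; exists g => //.
apply/seteqP; split=> [q /in0/onto [p Fp eqq]|_ [p /in1 Fp <-]].
  exists (iso_coord_inv p); first by apply/in1; rewrite iso_coord_invK.
  by apply: (can_inj (@iso_coordK K)); rewrite gm iso_coord_invK.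
by apply/in0/onto; exists (iso_coord p).
Qed.

End Signature.

Theorem theorem2p33 (R : realType) (C0 C1 : set (R[i] * R[i])%type)
    (d0 d1 : nat) (hd0 : (1 < d0)%N) (hd1 : (1 < d1)%N)
    (hC0 : irreducible_curve d0 C0) (hC1 : irreducible_curve d1 C1) :
  euclidean_equiv C0 C1 <-> joint_signature C0 = joint_signature C1.
Proof. exact: joint_signature_equiv hd0 hd1 hC0 hC1. Qed.
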